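(* For any invertible generalized hyperbolic operator $T$ on a locally convex space $X$ over $\mathbb{K}$ ($\mathbb{K}=\mathbb{R}$ or $\mathbb{C}$), the following assertions are equivalent: (i) $T$ is topologically expansive; (ii) $T$ is uniformly topologically expansive; (iii) $T$ is hyperbolic.
   Context: All topological vector spaces are Hausdorff. $\mathbb{N}_0=\{0,1,2,\dots\}$. ''Invertible operator'' means a continuous linear operator on $X$ with a continuous inverse. Let the topology of $X$ be induced by a family $(\|\cdot\|_\alpha)_{\alpha\in I}$ of seminorms that is directed (for all $\alpha,\beta\in I$ there is $\gamma\in I$ with $\|\cdot\|_\alpha\le\|\cdot\|_\gamma$ and $\|\cdot\|_\beta\le\|\cdot\|_\gamma$); all notions below do not depend on the choice of this family. An invertible $T$ is generalized hyperbolic if there is a topological direct sum decomposition $X=M\oplus N$ (algebraic direct sum with $(y,z)\mapsto y+z$ a homeomorphism $M\times N\to X$) such that $T(M)\subset M$, $T^{-1}(N)\subset N$, and for every $\alpha\in I$ there exist $\beta\in I$, $c>0$, $t\in(0,1)$ with $\|T^ny\|_\alpha\le c\,t^n\|y\|_\beta$ and $\|T^{-n}z\|_\alpha\le c\,t^n\|z\|_\beta$ for all $y\in M$, $z\in N$, $n\in\mathbb{N}_0$. $T$ is hyperbolic if there is such a decomposition for which both $M$ and $N$ are $T$-invariant ($T(M)\subset M$ and $T(N)\subset N$). $T$ is topologically expansive if for each nonzero $x\in X$ there exists $\alpha\in I$ with $\sup_{n\in\mathbb{Z}}\|T^nx\|_\alpha=\infty$. $T$ is uniformly topologically expansive if for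 every $\alpha\in I$ there exists $\beta\in I$ such that one can write $\{x\in X:\|x\|_\alpha=1\}=A_\alpha\cup B_\alpha$, where $\|T^nx\|_\beta\to\infty$ uniformly on $A_\alpha$ as $n\to\infty$ and $\|T^{-n}x\|_\beta\to\infty$ uniformly on $B_\alpha$ as $n\to\infty$. *)

(* Defs.v *)
From HB Require Import structures.
From mathcomp Require Import all_boot all_order all_algebra.
From mathcomp Require Import all_classical all_reals all_analysis.
From mathcomp Require Import complex.
Set Implicit Arguments.
Unset Strict Implicit.
Unset Printing Implicit Defensive.
Import Order.TTheory GRing.Theory Num.Theory.
Import numFieldNormedType.Exports.
Local Open Scope classical_set_scope.
Local Open Scope ring_scope.

Variant scalar_kind := real_scalars | complex_scalars.

Definition scalars (R : realType) (k : scalar_kind) : numFieldType :=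
  match k with
  | real_scalars => R
  | complex_scalars => R[i]
  end.

(* The norm of [R[i]] takes its values in [R[i]]; it is real, so its real part
   is the modulus as an element of [R]. *)
Definition modulus (R : realType) (k : scalar_kind) : scalars R k -> R :=
  match k return scalars R k -> R with
  | real_scalars => fun a : R => `|a|
  | complex_scalars => fun a : R[i] => complex.Re `|a|
  end.

Definition homeomorphism (A B : topologicalType) (f : A -> B) : Prop :=
  continuous f /\
  exists g : B -> A, [/\ cancel f g, cancel g f & continuous g].

Section Operators.
Context (R : realType) (k : scalar_kind) (X : tvsType (scalars R k)).

Definition is_seminorm (q : X -> R) : Prop :=
  [/\ forall x, 0 <= q x,
      forall x y, q (x + y) <= q x + q y &
      forall a x, q (a *: x) = modulus a * q x].

(* Linearity of the inverse is automatic. *)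
Record invertible_operator := InvertibleOperator {
  op :> {linear X -> X};
  op_inv : X -> X;
  opK : cancel op op_inv;
  op_invK : cancel op_inv op;
  op_continuous : continuous op;
  op_inv_continuous : continuous op_inv }.

Definition zpow (T : invertible_operator) (n : int) : X -> X :=
  match n with
  | Posz m => iter m T
  | Negz m => iter m.+1 (op_inv T)
  end.

(* [M] and [N], coerced to types, carry the topology induced by [X], and
   [M * N] the product topology; bijectivity of the addition map says that
   [X] is the algebraic direct sum of [M] and [N]. *)
Definition topological_direct_sum (M N : set X) : Prop :=
  [/\ submod_closed (mem M), submod_closed (mem N) &
      homeomorphism (fun yz : (M * N)%type => \val yz.1 + \val yz.2 : X)].

Section Seminorms.
Context (I : Type) (p : I -> X -> R).

Definition directed_family : Prop :=
  forall a b, exists c, forall x, p a x <= p c x /\ p b x <= p c x.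

Definition induces_topology : Prop :=
  forall (x : X) (U : set X), nbhs x U <->
    exists (F : set I) (e : R), [/\ finite_set F, 0 < e &
      [set y | forall a, F a -> p a (y - x) < e] `<=` U].

Definition generalized_hyperbolic_decomposition
    (T : invertible_operator) (M N : set X) : Prop :=
  [/\ topological_direct_sum M N,
      T @` M `<=` M,
      op_inv T @` N `<=` N &
      forall a, exists (b : I) (c t : R), [/\ 0 < c, 0 < t < 1 &
        forall (y z : X) (n : nat), M y -> N z ->
          p a (zpow T n%:Z y) <= c * t ^+ n * p b y /\
          p a (zpow T (- n%:Z) z) <= c * t ^+ n * p b z]].

Definition generalized_hyperbolic (T : invertible_operator) : Prop :=
  exists M N : set X, generalized_hyperbolic_decomposition T M N.

Definition hyperbolic (T : invertible_operator) : Prop :=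
  exists M N : set X, [/\ generalized_hyperbolic_decomposition T M N,
    T @` M `<=` M & T @` N `<=` N].

Definition topologically_expansive (T : invertible_operator) : Prop :=
  forall x : X, x != 0 -> exists a : I,
    ereal_sup [set (p a (zpow T n x))%:E | n in [set: int]] = +oo%E.

Definition diverges_uniformly (u : nat -> X -> R) (A : set X) : Prop :=
  forall r : R, \forall n \near \oo, forall x, A x -> r < u n x.

Definition uniformly_topologically_expansive (T : invertible_operator) : Prop :=
  forall a : I, exists (b : I) (A B : set X),
    [/\ [set x | p a x = 1] = A `|` B,
        diverges_uniformly (fun n x => p b (zpow T n%:Z x)) A &
        diverges_uniformly (fun n x => p b (zpow T (- n%:Z) x)) B].

End Seminorms.
End Operators.

(* Main.v *)
Require Import Defs.
From mathcomp Require Import all_boot all_order all_algebra.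
From mathcomp Require Import all_classical all_reals all_analysis.
From mathcomp Require Import complex lra.

(** Let [x = y + z] be the splitting of [x] along [M] and [N].  If [M] and [N]
    are invariant under [T] and [T^-1], the contraction estimates applied to
    [y = T^n (T^-n y)] and [z = T^-n (T^n z)] say that the backward orbit of [y]
    and the forward orbit of [z] grow geometrically; continuity of the
    projections transfers the growth to the orbit of [x], and one of [y], [z]
    has at least half of the size of [x].  Conversely, for [z] in [N] the
    [M]-component of [T z] has a forward orbit bounded as an element of [M], and
    a backward orbit bounded as the difference of two elements of
    [T N + N = T N]; expansivity forces it to vanish, so that [T N] is contained
    in [N]. *)

Set Implicit Arguments.
Unset Strict Implicit.
Unset Printing Implicit Defensive.
Import Order.TTheory GRing.Theory Num.Theory.
Import numFieldNormedType.Exports.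
Local Open Scope classical_set_scope.
Local Open Scope ring_scope.

(** * Real scalars inside the scalar field *)

Section Scalars.
Context (R : realType) (k : scalar_kind).

(** Allows vectors to be normalised by real factors, whichever scalar field is in use. *)
Definition real_scalar : R -> scalars R k :=
  match k return R -> scalars R k with
  | real_scalars => fun r => r
  | complex_scalars => fun r => (r%:C)%C
  end.

Lemma modulus_real_scalar (r : R) : modulus (real_scalar r) = `|r|.
Proof.
rewrite /real_scalar; case: k => //=.
by rewrite expr0n /= addr0 sqrtr_sqr.
Qed.

Lemma modulusN1 : modulus (-1 : scalars R k) = 1.
Proof.
by case: k => /=; rewrite ?normrN1 // oppr0 expr0n addr0 sqrtr_sqr normrN1.
Qed.

End Scalars.

Section Seminorm.
Context (R : realType) (k : scalar_kind) (X : tvsType (scalars R k)).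
Context (q : X -> R) (q_seminorm : is_seminorm q).

Lemma seminorm_ge0 x : 0 <= q x.
Proof. by case: q_seminorm. Qed.

Lemma seminormD x y : q (x + y) <= q x + q y.
Proof. by case: q_seminorm. Qed.

Lemma seminorm_real_scalar r x : q (real_scalar k r *: x) = `|r| * q x.
Proof. by case: q_seminorm => _ _ ->; rewrite modulus_real_scalar. Qed.

Lemma seminormN x : q (- x) = q x.
Proof. by rewrite -scaleN1r; case: q_seminorm => _ _ ->; rewrite modulusN1 mul1r. Qed.

Lemma seminormB x y : q (x - y) <= q x + q y.
Proof. by rewrite -(seminormN y) seminormD. Qed.

End Seminorm.

(** * Iterates of linear maps *)

Section Operator.
Context (R : realType) (k : scalar_kind) (X : tvsType (scalars R k)).
Context (T : invertible_operator X).

Lemma zpow_opp (n : nat) x : zpow T (- n%:Z) x = iter n (op_inv T) x.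
Proof. by case: n. Qed.

Lemma op_inv_linear : linear (op_inv T).
Proof.
by move=> a x y; apply: (can_inj (opK T)); rewrite linearP !op_invK.
Qed.

Lemma iter_linear (f : X -> X) (n : nat) : linear f -> linear (iter n f).
Proof. by move=> fL; elim: n => // n IH a x y; rewrite /= IH fL. Qed.

Lemma linear_additive (f : X -> X) : linear f -> {morph f : x y / x + y}.
Proof. by move=> fL x y; rewrite -[x in LHS]scale1r fL scale1r. Qed.

Lemma linear_homogeneous (f : X -> X) : linear f -> forall a, {morph f : x / a *: x}.
Proof.
move=> fL a x; have f0 : f 0 = 0.
  have /eqP := linear_additive fL 0 0.
  by rewrite addr0 addrC -subr_eq subrr => /eqP.
by rewrite -[a *: x]addr0 fL f0 addr0.
Qed.

Lemma iter_cancel (f g : X -> X) (n : nat) : cancel f g -> cancel (iter n f) (iter n g).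
Proof. by move=> fK; elim: n => // n IH x; rewrite (iterS n f) (iterSr n g) fK IH. Qed.

Lemma iter_sub (f : X -> X) (A : set X) (n : nat) x :
  f @` A `<=` A -> A x -> A (iter n f x).
Proof. by move=> fA Ax; elim: n => //= n IH; apply: fA; exists (iter n f x). Qed.

End Operator.

(** * Projections of a topological direct sum *)

Section DirectSum.
Context (R : realType) (k : scalar_kind) (X : tvsType (scalars R k)).

(** [P] and [Q] are the projections, taken as maps from [X] to itself so that continuity no longer
    involves the subtypes of [M] and [N]. *)
Record splitting (M N : set X) (P Q : X -> X) : Prop := Splitting {
  split_left x : M (P x);
  split_right x : N (Q x);
  splitE x : P x + Q x = x;
  split_unique y z : M y -> N z -> P (y + z) = y /\ Q (y + z) = z;
  split_left_continuous : continuous P;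
  split_right_continuous : continuous Q;
  split_left_submod : submod_closed (mem M);
  split_right_submod : submod_closed (mem N) }.

Lemma topological_direct_sum_splitting (M N : set X) :
  topological_direct_sum M N -> exists P Q, splitting M N P Q.
Proof.
case=> Ms Ns [_ [g [gK Kg gc]]].
exists (fun x => \val (g x).1), (fun x => \val (g x).2); split=> //.
- by move=> x; apply: set_mem; apply: valP.
- by move=> x; apply: set_mem; apply: valP.
- move=> y z /mem_set My /mem_set Nz.
  by have := gK (exist _ y My, exist _ z Nz) => /= ->.
- move=> x; apply: (@continuous_comp _ _ _ (fun x => (g x).1) (fun u => \val u)).
    by apply: (@continuous_comp _ _ _ g fst); [exact: gc|exact: cvg_fst].
  exact: initial_continuous.
- move=> x; apply: (@continuous_comp _ _ _ (fun x => (g x).2) (fun u => \val u)).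
    by apply: (@continuous_comp _ _ _ g snd); [exact: gc|exact: cvg_snd].
  exact: initial_continuous.
Qed.

Lemma submod_closed0 (M : set X) : submod_closed (mem M) -> M 0.
Proof. by case=> M0 _; exact: set_mem. Qed.

Lemma submod_closedP (M : set X) a x y :
  submod_closed (mem M) -> M x -> M y -> M (a *: x + y).
Proof. by case=> _ ML /mem_set Mx /mem_set My; exact/set_mem/ML. Qed.

(** Lets facts about the left projection serve the right one. *)
Lemma splittingC (M N : set X) P Q : splitting M N P Q -> splitting N M Q P.
Proof.
case=> ? ? PQ PQu ? ? ? ?; split=> //; first by move=> x; rewrite addrC.
by move=> y z Ny Mz; rewrite addrC; have [] := PQu _ _ Mz Ny.
Qed.

Lemma split_left_linear (M N : set X) P Q : splitting M N P Q -> linear P.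
Proof.
move=> S a x y; have -> : a *: x + y = (a *: P x + P y) + (a *: Q x + Q y).
  by rewrite -{1}(splitE S x) -{1}(splitE S y) scalerDr addrACA.
apply: (split_unique S _ _).1.
  by apply: submod_closedP (split_left_submod S) _ _; exact: split_left S _.
by apply: submod_closedP (split_right_submod S) _ _; exact: split_right S _.
Qed.

(** By invariance, [f (P x) + f (Q x)] is the unique splitting of [f x]. *)
Lemma split_left_commute (M N : set X) P Q (f : X -> X) :
  splitting M N P Q -> linear f -> f @` M `<=` M -> f @` N `<=` N ->
  forall x, P (f x) = f (P x).
Proof.
move=> S fL fM fN x; rewrite -[in LHS](splitE S x) (linear_additive fL).
by apply: (split_unique S _ _).1; [apply: fM; exists (P x)|apply: fN; exists (Q x)];
  rewrite //; [exact: split_left S x|exact: split_right S x].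
Qed.

(** Commutation gives [f (P (g m)) = P (f (g m)) = P m = m], and injectivity of [f] then gives
    [P (g m) = g m]. *)
Lemma inverse_left_invariant (M N : set X) P Q (f g : X -> X) :
  splitting M N P Q -> cancel f g -> cancel g f -> linear f ->
  f @` M `<=` M -> f @` N `<=` N -> g @` M `<=` M.
Proof.
move=> S fK gK fL fM fN _ [m Mm <-].
have [Pm _] := split_unique S Mm (submod_closed0 (split_right_submod S)).
rewrite addr0 in Pm; have -> : g m = P (g m).
  by apply: (can_inj fK); rewrite -(split_left_commute S fL fM fN) gK Pm.
exact: split_left S _.
Qed.

End DirectSum.

(** * Directed families of seminorms inducing the topology *)

Section SeminormFamily.
Context (R : realType) (k : scalar_kind) (X : tvsType (scalars R k)).
Context (I : Type) (p : I -> X -> R).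
Hypothesis p_seminorm : forall a, is_seminorm (p a).
Hypothesis p_directed : directed_family p.
Hypothesis p_topology : induces_topology p.

Lemma finite_dominated (b : I) (F : set I) : finite_set F ->
  exists c, forall a x, F a -> p a x <= p c x.
Proof.
move=> /(@finite_seqP {classic I}) [s ->] {F}.
(* The index [b] is the answer for the empty set. *)
elim: s => [|a s [c sc]]; first by exists b.
have [d cd] := p_directed a c.
exists d => a' x /=; rewrite inE => /predU1P[->|a's]; first exact: (cd x).1.
exact: le_trans (sc _ x a's) (cd x).2.
Qed.

(** Continuity at 0 and directedness keep [p b (f x)] below 1 on a ball [p c x < e]; homogeneity
    gives the constant [e^-1]. *)
Lemma continuous_linear_bounded (f : X -> X) (b : I) :
  linear f -> continuous f ->
  exists c (C : R), 0 < C /\ forall x, p b (f x) <= C * p c x.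
Proof.
move=> fL fc.
have f0 : f 0 = 0 by rewrite -(scale0r 0) (linear_homogeneous fL) !scale0r.
have : nbhs (0 : X) (f @^-1` [set y | p b y < 1]).
  apply: fc; rewrite f0; apply/p_topology; exists [set b], 1; split=> //.
  by move=> y /= /(_ b erefl); rewrite subr0.
move=> /p_topology[F [e [/(finite_dominated b)[c Fc] e0 sub]]].
exists c, e^-1; rewrite invr_gt0; split=> // x.
rewrite leNgt; apply/negP; rewrite mulrC ltr_pdivrMr // => lt.
have s0 : 0 < p b (f x).
  rewrite -(pmulr_lgt0 _ e0); apply: le_lt_trans lt; exact: seminorm_ge0.
(* A counterexample [x] divided by [p b (f x)] would lie in that ball, while its image has seminorm
   exactly 1. *)
have : p b (f (real_scalar k (p b (f x))^-1 *: x)) < 1.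
  apply: sub => a Fa; rewrite subr0; apply: le_lt_trans (Fc _ _ Fa) _.
  by rewrite seminorm_real_scalar // gtr0_norm ?invr_gt0 // ltr_pdivrMl.
rewrite (linear_homogeneous fL) seminorm_real_scalar // gtr0_norm ?invr_gt0 //.
by rewrite mulVf ?ltxx // gt_eqF.
Qed.

(** If all seminorms vanished at [x], then [x] would lie in every neighbourhood of 0. *)
Lemma seminorms_separate (x : X) : hausdorff_space X -> x != 0 ->
  exists a, 0 < p a x.
Proof.
move=> hX x0; apply: contrapT => H; move/eqP: x0; apply.
apply: hX => A B xA /p_topology[F [e [_ e0 FB]]].
exists x; split; first exact: nbhs_singleton.
apply: FB => a _; rewrite subr0; apply: le_lt_trans e0.
by rewrite leNgt; apply/negP => ?; apply: H; exists a.
Qed.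

(** As [g] undoes [f] and [P] commutes with [f], [p a (P x)] is at most
    [K * C * t ^+ n * p c (iter n f x)]; a lower bound 1/2 on the left forces growth uniform in [x].
    The pair [f], [g] is general because the lemma serves both time directions. *)
Lemma expanded_component_diverges (M N : set X) P Q (f g : X -> X) (a b c : I)
    (K C t : R) :
  splitting M N P Q -> cancel f g -> linear f ->
  f @` M `<=` M -> f @` N `<=` N -> 0 < K -> 0 < C -> 0 < t < 1 ->
  (forall y n, M y -> p a (iter n g y) <= K * t ^+ n * p b y) ->
  (forall x, p b (P x) <= C * p c x) ->
  diverges_uniformly (fun n x => p c (iter n f x)) [set x | 2^-1 <= p a (P x)].
Proof.
move=> S fK fL fM fN K0 C0 /andP[t0 t1] contr PC r.
(* The added 1 keeps the divisor positive when [r] is 0. *)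
have KCr : 0 < K * C * (`|r| + 1) by rewrite !mulr_gt0 // ltr_wpDl.
have tn : \forall n \near \oo, t ^+ n < 2^-1 / (K * C * (`|r| + 1)).
  have t1' : `|t| < 1 by rewrite gtr0_norm.
  have := cvgr_lt 0 (cvg_expr t1'); apply.
  by rewrite divr_gt0 // invr_gt0.
apply: filterS tn => n; rewrite ltr_pdivlMr // => tn x /= half.
have Pf : P (iter n f x) = iter n f (P x).
  by apply: (split_left_commute S (iter_linear n fL)) => _ [y Ay <-]; apply: iter_sub.
have := contr _ n (iter_sub n fM (split_left S x)).
rewrite iter_cancel // -Pf => le1.
rewrite ltNge; apply/negP => le_r.
suff : p a (P x) < 2^-1 by rewrite ltNge half.
apply: le_lt_trans le1 _; apply: le_lt_trans tn.
have -> : t ^+ n * (K * C * (`|r| + 1)) = K * t ^+ n * (C * (`|r| + 1)).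
  by rewrite mulrCA -!mulrA; congr (_ * _); rewrite mulrCA.
apply: ler_wpM2l; first by rewrite mulr_ge0 ?ltW // exprn_gt0.
apply: le_trans (PC _) _; apply: ler_wpM2l; first exact: ltW.
by apply: le_trans le_r _; have := ler_norm r; lra.
Qed.

Lemma diverges_uniformly_sub (u : nat -> X -> R) (A B : set X) :
  A `<=` B -> diverges_uniformly u B -> diverges_uniformly u A.
Proof. by move=> AB uB r; apply: filterS (uB r) => n un x /AB; exact: un. Qed.

(** * The three implications *)

Context (T : invertible_operator X).

Lemma hyperbolic_uniformly_expansive :
  hyperbolic p T -> uniformly_topologically_expansive p T.
Proof.
move=> [M [N [[/topological_direct_sum_splitting[P [Q S]] _ iN contr] TM TN]]] a.
have S' := splittingC S.
have TL : linear T by move=> ? ? ?; rewrite linearP.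
(* The backward half applies the growth lemma to the inverse, which must preserve [M] too. *)
have iM := inverse_left_invariant S (opK T) (op_invK T) TL TM TN.
have [b [K [t [K0 t01 est]]]] := contr a.
have [c1 [C1 [C10 PC]]] :=
  continuous_linear_bounded b (split_left_linear S) (split_left_continuous S).
have [c2 [C2 [C20 QC]]] :=
  continuous_linear_bounded b (split_left_linear S') (split_right_continuous S).
have [c cP] := p_directed c1 c2.
have cPC x : p b (P x) <= C1 * p c x.
  by apply: le_trans (PC x) _; rewrite ler_pM2l //; exact: (cP x).1.
have cQC x : p b (Q x) <= C2 * p c x.
  by apply: le_trans (QC x) _; rewrite ler_pM2l //; exact: (cP x).2.
(* A large [N]-component grows forward and a large [M]-component backward; the triangle inequality
   makes one of them at least 1/2. *)
exists c, [set x | p a x = 1 /\ 2^-1 <= p a (Q x)],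
  [set x | p a x = 1 /\ 2^-1 <= p a (P x)]; split.
- apply/seteqP; split=> x /=; last by case=> [[]|[]].
  move=> x1; case: (lerP 2^-1 (p a (Q x))) => [|Qx]; [by left|right; split=> //].
  have := seminormD (p_seminorm a) (P x) (Q x).
  by rewrite (splitE S) x1; lra.
- apply: (@diverges_uniformly_sub _ _ [set x | 2^-1 <= p a (Q x)]).
    by move=> x [].
  apply: (expanded_component_diverges S' (opK T) TL TN TM K0 C20 t01 _ cQC).
  move=> y n Ny; rewrite -zpow_opp.
  (* The estimate takes a vector from each summand; 0 fills the place of the one in [M]. *)
  exact: (est 0 y n (submod_closed0 (split_left_submod S)) Ny).2.
- have -> : (fun (n : nat) x => p c (zpow T (- n%:Z) x)) =
            (fun n x => p c (iter n (op_inv T) x)).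
    by apply/funext => n; apply/funext => x; rewrite zpow_opp.
  apply: (@diverges_uniformly_sub _ _ [set x | 2^-1 <= p a (P x)]).
    by move=> x [].
  apply: (expanded_component_diverges S (op_invK T) (op_inv_linear T)
    iM iN K0 C10 t01 _ cPC).
  move=> y n My.
  exact: (est y 0 n My (submod_closed0 (split_right_submod S))).1.
Qed.

Lemma zpow_homogeneous n a : {morph zpow T n : x / a *: x}.
Proof.
apply: linear_homogeneous; case: n => n; apply: iter_linear; last exact: op_inv_linear.
by move=> ? ? ?; rewrite linearP.
Qed.

(** A nonzero vector, scaled to have [p a] equal to 1, falls in [A] or [B]; its orbit is unbounded,
    and scaling back preserves this. *)
Lemma uniformly_expansive_expansive : hausdorff_space X ->
  uniformly_topologically_expansive p T -> topologically_expansive p T.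
Proof.
move=> hX uexp x /(seminorms_separate hX)[a ax].
have [b [A [B [AB dA dB]]]] := uexp a; exists b.
set s := (p a x)^-1; have s0 : 0 < s by rewrite invr_gt0.
pose y := real_scalar k s *: x.
have y1 : p a y = 1 by rewrite seminorm_real_scalar // gtr0_norm // mulVf // gt_eqF.
have unbounded r : exists n : int, r < p b (zpow T n x).
  suff [n] : exists n : int, s * r < p b (zpow T n y).
    rewrite zpow_homogeneous seminorm_real_scalar // gtr0_norm // ltr_pM2l // => lt.
    by exists n.
  have : (A `|` B) y by rewrite -AB.
  case=> [Ay|By].
    by have [n _ /(_ n (leqnn n) _ Ay)] := dA (s * r); exists n%:Z.
  by have [n _ /(_ n (leqnn n) _ By)] := dB (s * r); exists (- n%:Z).
apply/eqyP => r _; have [n lt] := unbounded r.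
apply: (@le_trans _ _ (p b (zpow T n x))%:E); first by rewrite lee_fin ltW.
by apply: ereal_sup_ubound; exists n.
Qed.

Lemma bounded_orbit_eq0 (x : X) : topologically_expansive p T ->
  (forall a, exists C : R, forall n : nat,
    p a (zpow T n%:Z x) <= C /\ p a (zpow T (- n%:Z) x) <= C) -> x = 0.
Proof.
move=> texp bnd; apply/eqP; apply/negPn/negP => /texp[a].
have [C xC] := bnd a; apply/eqP; rewrite lt_eqF //.
apply: (@le_lt_trans _ _ C%:E); last exact: ltry.
apply: ge_ereal_sup => _ [n _ <-]; rewrite lee_fin.
(* [Negz n] is the integer [-(n + 1)]. *)
by case: n => n; [exact: (xC n).1|exact: (xC n.+1).2].
Qed.

Lemma expansive_hyperbolic : generalized_hyperbolic p T ->
  topologically_expansive p T -> hyperbolic p T.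
Proof.
move=> [M [N dec]] texp; exists M, N.
have [/topological_direct_sum_splitting[P [Q S]] TM iN contr] := dec.
split=> // _ [z Nz <-].
suff P0 : P (T z) = 0 by rewrite -(splitE S (T z)) P0 add0r; exact: split_right S _.
apply: bounded_orbit_eq0 => // a.
have [b [K [t [K0 /andP[t0 t1] est]]]] := contr a.
have tn n : K * t ^+ n <= K.
  by rewrite ler_piMr ?(ltW K0) // exprn_ile1 ?(ltW t0) ?(ltW t1).
have fwd n y : M y -> p a (iter n T y) <= K * p b y.
  move=> My.
  apply: le_trans (est y 0 n My (submod_closed0 (split_right_submod S))).1 _.
  by apply: ler_wpM2r => //; exact: seminorm_ge0.
have bwd n w : N w -> p a (iter n (op_inv T) w) <= K * p b w.
  move=> Nw; rewrite -zpow_opp.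
  apply: le_trans (est 0 w n (submod_closed0 (split_left_submod S)) Nw).2 _.
  by apply: ler_wpM2r => //; exact: seminorm_ge0.
have ge0 y : 0 <= K * p b y by rewrite mulr_ge0 ?(ltW K0) ?seminorm_ge0.
have age0 y : 0 <= p a y by exact: seminorm_ge0.
(* The first term bounds the forward orbit of [P (T z)]; the bracket bounds the backward orbit of
   [T z - Q (T z)]. *)
exists (K * p b (P (T z)) +
  (p a (T z) + K * p b z + K * p b (Q (T z)))) => n.
split.
  apply: le_trans (fwd n _ (split_left S _)) _.
  by rewrite lerDl !addr_ge0.
rewrite zpow_opp; apply: (@le_trans _ _ (p a (iter n (op_inv T) (T z)) +
    p a (iter n (op_inv T) (Q (T z))))).
  rewrite -(addrK (Q (T z)) (P (T z))) (splitE S).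
  rewrite [_ - Q _]addrC -scaleN1r (iter_linear n (op_inv_linear T)) scaleN1r addrC.
  exact: seminormB.
have := bwd n _ (split_right S (T z)).
suff : p a (iter n (op_inv T) (T z)) <= p a (T z) + K * p b z.
  by move: (ge0 (P (T z))); lra.
(* [T z] is not yet known to lie in [N], so [n = 0] is separate; afterwards one inverse cancels [T]
   and leaves the backward orbit of [z]. *)
case: n => [|n]; first by rewrite lerDl.
by rewrite iterSr opK; apply: le_trans (bwd n _ Nz) _; rewrite lerDr.
Qed.

End SeminormFamily.

Theorem theorem36 (R : realType) (k : scalar_kind) (X : tvsType (scalars R k))
    (X_hausdorff : hausdorff_space X)
    (I : Type) (p : I -> X -> R)
    (p_seminorm : forall a, is_seminorm (p a))
    (p_directed : directed_family p)
    (p_topology : induces_topology p)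
    (T : invertible_operator X)
    (T_gh : generalized_hyperbolic p T) :
  (topologically_expansive p T <-> uniformly_topologically_expansive p T) /\
  (uniformly_topologically_expansive p T <-> hyperbolic p T).
Proof.
(* The implications form the cycle (iii), (ii), (i), (iii). *)
have hu := hyperbolic_uniformly_expansive p_seminorm p_directed p_topology (T := T).
have ut := uniformly_expansive_expansive p_seminorm p_topology X_hausdorff (T := T).
have th := expansive_hyperbolic p_seminorm T_gh.
by split; split; auto.
Qed.
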